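(* Let $X\subset\mathbb{R}^n$ be a closed and unbounded set, let $I=\{1,\ldots,m\}$, and let $f=(f_1,\ldots,f_m):\mathbb{R}^n\to\mathbb{R}^m$ be such that each $f_i:\mathbb{R}^n\to\mathbb{R}$, $i\in I$, is lower semicontinuous. Assume that $X$ is convex and $f$ is $\mathbb{R}^m_+$-convex. If the set-valued mapping $\mathrm{Sol}^w(\cdot):\mathbb{R}^{m\times n}\rightrightarrows\mathbb{R}^n$ is lower semicontinuous at $0$, then the following statements are equivalent: (a) $\mathrm{Sol}^w(0)$ is bounded. (b) $X^{\infty}\cap\big(\bigcup_{i\in I}\mathcal{K}(f_i)\big)=\{0\}$.
   Context: All spaces are Euclidean. $f$ is $\mathbb{R}^m_+$-convex means that each component $f_i$ is convex. For $u=(u_1,\ldots,u_m)\in\mathbb{R}^{m\times n}$ with $u_i\in\mathbb{R}^n$, put $\|u\|:=\max_{i\in I}\|u_i\|$ and $f_i^{u_i}(x):=f_i(x)-\langle u_i,x\rangle$. $\mathrm{Sol}^w(u)$ is the set of weak Pareto solutions of minimizing $f^u:=(f_1^{u_1},\ldots,f_m^{u_m})$ over $X$, i.e., of all $\bar x\in X$ such that there is no $x\in X$ with $f_i^{u_i}(x)<f_i^{u_i}(\bar x)$ for all $i\in I$. Asymptotic cone: $X^\infty:=\{d\in\mathbb{R}^n:\exists\, t_k\to+\infty,\ \exists\, x_k\in X,\ x_k/t_k\to d\}$. Asymptotic function of $\varphi:\mathbb{R}^n\to\mathbb{R}$: $\varphi^\infty(d):=\inf\{\liminf_{k\to\infty}\varphi(t_kd_k)/t_k:\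 t_k\to+\infty,\ d_k\to d\}$. $\mathcal{K}(\varphi):=\{d\in\mathbb{R}^n:\varphi^\infty(d)\le 0\}$. A set-valued mapping $F$ is lower semicontinuous at $\bar u$ if $F(\bar u)\neq\emptyset$ and for every open set $V$ with $F(\bar u)\cap V\neq\emptyset$ there is a neighborhood $U$ of $\bar u$ such that $F(u)\cap V\neq\emptyset$ for all $u\in U$. *)

(* Defs.v *)
From mathcomp Require Import all_boot all_order all_algebra.
From mathcomp Require Import all_classical all_reals all_analysis.

Set Implicit Arguments.
Unset Strict Implicit.
Unset Printing Implicit Defensive.

Import Order.TTheory GRing.Theory Num.Theory.
Import numFieldNormedType.Exports.

Local Open Scope classical_set_scope.
Local Open Scope ring_scope.

(* Topology and boundedness on 'rV[R]_n and 'M[R]_(m, n) are the library's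
   (product topology, entrywise max norm). Lemmas [nbhs_rows_normP] and
   [bounded_enormP] below check that they agree with those of the Euclidean
   norm and of |u| := max_i |u_i|. *)

Section VectorOptimization.
Context {R : realType} {m n : nat}.
Implicit Types (X : set 'rV[R]_n) (f : 'I_m -> 'rV[R]_n -> R).

Definition inner (x y : 'rV[R]_n) : R := \sum_j x ord0 j * y ord0 j.

Definition perturbed f (u : 'M[R]_(m, n)) : 'I_m -> 'rV[R]_n -> R :=
  fun i x => f i x - inner (row i u) x.

Definition weak_pareto X f : set 'rV[R]_n :=
  [set xbar | X xbar /\ ~ exists2 x, X x & forall i, f i x < f i xbar].

Definition Solw X f (u : 'M[R]_(m, n)) : set 'rV[R]_n :=
  weak_pareto X (perturbed f u).

Definition asymptotic_cone X : set 'rV[R]_n :=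
  [set d | exists (t : nat -> R) (x : nat -> 'rV[R]_n),
    [/\ t k @[k --> \oo] --> +oo,
        (forall k, X (x k)) &
        (t k)^-1 *: x k @[k --> \oo] --> d]].

(* The finitely many k with t k = 0, where division is by convention 0, do not
   affect the limit inferior (and similarly above). *)
Definition asymptotic_function (phi : 'rV[R]_n -> R) (d : 'rV[R]_n) : \bar R :=
  ereal_inf [set l | exists (t : nat -> R) (dk : nat -> 'rV[R]_n),
    [/\ t k @[k --> \oo] --> +oo,
        dk k @[k --> \oo] --> d &
        l = limn_einf (fun k => (phi (t k *: dk k) / t k)%:E)]].

Definition asymptotic_kernel (phi : 'rV[R]_n -> R) : set 'rV[R]_n :=
  [set d | (asymptotic_function phi d <= 0)%E].

Definition enorm (x : 'rV[R]_n) : R := Num.sqrt (inner x x).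

Definition rows_norm (u : 'M[R]_(m, n)) : R :=
  \big[Num.max/0]_(i < m) enorm (row i u).

End VectorOptimization.

Definition set_valued_lsc_at {T S : topologicalType} (F : T -> set S) (u0 : T) :=
  F u0 !=set0 /\
  forall V : set S, open V -> F u0 `&` V !=set0 ->
    \forall u \near u0, F u `&` V !=set0.

Section NormComparison.
Context {R : realType}.

Lemma entry_le_enorm n (x : 'rV[R]_n) j : `|x ord0 j| <= enorm x.
Proof.
rewrite /enorm -sqrtr_sqr ler_wsqrtr// /inner (bigD1 j)//= expr2 lerDl.
by apply: sumr_ge0 => k _; rewrite -expr2 sqr_ge0.
Qed.

Lemma mx_entry_le m n (u : 'M[R]_(m, n)) i j : `|u i j| <= `|u|.
Proof. by rewrite [leRHS]/Num.norm/= mx_normrE; apply: (le_bigmax _ _ (i, j)). Qed.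

Lemma enorm_row_le m n (u : 'M[R]_(m, n)) i :
  enorm (row i u) <= Num.sqrt n%:R * `|u|.
Proof.
rewrite -[X in _ * X]ger0_norm ?normr_ge0// -sqrtr_sqr -sqrtrM ?ler0n//.
rewrite /enorm ler_wsqrtr// /inner.
apply: (@le_trans _ _ (\sum_(j < n) `|u| ^+ 2)); last first.
  by rewrite sumr_const card_ord mulr_natl.
apply: ler_sum => j _; rewrite !mxE -expr2 -real_normK ?num_real//.
by rewrite lerXn2r ?nnegrE ?normr_ge0// mx_entry_le.
Qed.

Lemma rows_norm_le m n (u : 'M[R]_(m, n)) :
  rows_norm u <= Num.sqrt n%:R * `|u|.
Proof.
apply/bigmax_leP; split; first by rewrite mulr_ge0 ?sqrtr_ge0.
by move=> i _; exact: enorm_row_le.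
Qed.

Lemma mx_norm_le_rows_norm m n (u : 'M[R]_(m, n)) : `|u| <= rows_norm u.
Proof.
rewrite [leLHS]/Num.norm/= mx_normrE; apply/bigmax_leP; split.
  exact: bigmax_ge_id.
move=> [i j] _ /=; apply: (@le_trans _ _ (enorm (row i u))).
  by have := entry_le_enorm (row i u) j; rewrite mxE.
exact: (le_bigmax _ _ i).
Qed.

Lemma nbhs_rows_normP m n (u : 'M[R]_(m, n)) (A : set 'M[R]_(m, n)) :
  nbhs u A <-> exists2 e : R, 0 < e & forall v, rows_norm (v - u) < e -> A v.
Proof.
split=> [/nbhs_normP[e /= e0 uA]|[e e0 uA]].
  exists e => // v vu; apply: uA; rewrite /= distrC.
  exact: le_lt_trans (mx_norm_le_rows_norm _) vu.
have c0 : 0 < Num.sqrt n%:R + 1 :> R by rewrite ltr_wpDl ?sqrtr_ge0.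
rewrite -nbhs_nbhs_norm; exists (e / (Num.sqrt n%:R + 1)) => /=; first by rewrite divr_gt0.
move=> v /=; rewrite distrC ltr_pdivlMr// => vu; apply: uA.
apply: le_lt_trans (rows_norm_le _) _; apply: le_lt_trans vu.
by rewrite mulrC ler_wpM2l// lerDl.
Qed.

Lemma bounded_enormP n (A : set 'rV[R]_n) :
  bounded_set A <-> exists M : R, forall x, A x -> enorm x <= M.
Proof.
have rowE (x : 'rV[R]_n) : row ord0 x = x by apply/rowP => j; rewrite mxE.
split=> [/ex_strict_bound_gt0[M M0 AM]|[M AM]].
  exists (Num.sqrt n%:R * M) => x /AM /= xM.
  rewrite -[x in enorm x]rowE (le_trans (enorm_row_le _ _))//.
  by rewrite ler_wpM2l ?sqrtr_ge0// ltW.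
exists M; split; first exact: num_real.
move=> N MN x /= /AM xM; apply: le_trans (ltW MN).
apply: le_trans xM; rewrite (le_trans (mx_norm_le_rows_norm _))//.
apply/bigmax_leP; split; first exact: sqrtr_ge0.
by move=> i _; rewrite ord1 rowE.
Qed.

End NormComparison.

(* Main.v *)
Require Import Defs.
From mathcomp Require Import all_boot all_order all_algebra.
From mathcomp Require Import all_classical all_reals all_analysis.
From mathcomp Require Import ring lra.

Import Order.TTheory GRing.Theory Num.Theory.
Import numFieldNormedType.Exports.

Local Open Scope classical_set_scope.
Local Open Scope ring_scope.

(** Throughout, let X^oo be the asymptotic cone of X, K(f_i) the kernel of the
    asymptotic function of f_i, and Sol the set of weak Pareto solutions of the
    unperturbed problem.

    (b) => (a).  Fix x0 in X.  A weak Pareto point x has f_i(x) <= f_i(x0) for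
    some i, so Sol lies in the union of the m sublevel sets
    X_i = {x in X : f_i(x) <= f_i(x0)}.  If Sol were unbounded, some X_i would
    be; by compactness of the unit sphere an unbounded set has a nonzero
    asymptotic direction ([unbounded_asymptotic_direction]), and such a
    direction of a sublevel set of f_i lies in K(f_i)
    ([sublevel_asymptotic_kernel]), which contradicts (b).

    (a) => (b).  By convexity, a direction d of X^oo can be followed inside X
    from any point of X ([asymptotic_cone_translate]), and f_i does not increase
    along a direction of K(f_i) ([asymptotic_kernel_descent]).  Two facts follow
    when Sol is nonempty and bounded.

    - Every set A_b = {x in X : f_j(x) <= b_j for all j} is bounded
      ([bounded_weak_pareto_sublevels]).  Otherwise a nonzero asymptotic
      direction of A_b would lie in all K(f_j) at once; no f_j would increase
      along the ray that leaves a weak Pareto point in this direction, and the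
      ray would consist of weak Pareto points.

    - Every f_i attains its minimum over X ([bounded_weak_pareto_minimizer]).
      Minimize f_i over the compact set A_b, where b_i is the value of f_i at
      some point of Sol and the other b_j strictly exceed the supremum of f_j
      over a ball that contains Sol; this supremum is finite because f_j is
      convex ([convex_bounded_above]).  A minimizer w belongs to Sol, since a
      point better than w in all components would also lie in A_b.  Hence w lies
      in the ball, the constraints with j <> i are slack at w, and w minimizes
      f_i locally, hence globally, over X.

    Now let d <> 0 lie in X^oo and in K(f_i), and let w minimize f_i over X.
    The ray from w in direction d stays among the minimizers of f_i, all of
    which are weak Pareto points; so Sol is unbounded, a contradiction. *)

(** * Sequences along which scalars tend to infinity *)

Section ScalarsToInfinity.
Context {R : realType}.
Implicit Types t : nat -> R.

Lemma cvgy_near_gt0 t : t k @[k --> \oo] --> +oo -> \forall k \near \oo, 0 < t k.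
Proof. by move=> /cvgryPgt/(_ 0). Qed.

Lemma cvgy_inv0 t : t k @[k --> \oo] --> +oo -> (t k)^-1 @[k --> \oo] --> (0 : R).
Proof. by move=> ty; apply/(gtr0_cvgV0 (cvgy_near_gt0 _ ty)). Qed.

Lemma cvgy_div t (c : R) :
  t k @[k --> \oo] --> +oo -> c / t k @[k --> \oo] --> (0 : R).
Proof.
move=> ty; rewrite -(mulr0 c).
by apply: cvgM; [exact: cvg_cst|exact: cvgy_inv0].
Qed.

End ScalarsToInfinity.

(** * Bounded sets and recession directions *)

Section Recession.
Context {R : realType} {n : nat}.
Implicit Types (A X : set 'rV[R]_n) (phi : 'rV[R]_n -> R) (x d : 'rV[R]_n).

Lemma bounded_setP A :
  bounded_set A <-> exists M : R, forall x, A x -> `|x| <= M.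
Proof.
split=> [/ex_strict_bound_gt0[M M0 AM]|[M AM]].
  by exists M => x /AM /ltW.
exists M; split; first exact: num_real.
by move=> N MN x /= /AM xM; exact: le_trans xM (ltW MN).
Qed.

Lemma ray_unbounded A (x d : 'rV[R]_n) : d != 0 ->
  (forall s, 0 <= s -> A (x + s *: d)) -> ~ bounded_set A.
Proof.
move=> d0 ray /bounded_setP[M AM].
have M0 : 0 <= M by apply: le_trans (AM _ (ray 0 (lexx 0))).
have dp : 0 < `|d| by rewrite normr_gt0.
pose s := (M + `|x| + 1) / `|d|.
have s0 : 0 <= s by rewrite divr_ge0// !addr_ge0.
have := AM _ (ray s s0); apply/negP; rewrite -ltNge.
have : `|s *: d| <= `|x + s *: d| + `|x|.
  by rewrite -{1}[s *: d](addKr x) addrC (le_trans (ler_normB _ _)).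
by rewrite normrZ ger0_norm// /s divfK ?gt_eqF//; lra.
Qed.

Lemma convex_setP X x y (s : R) : convex_set X -> X x -> X y ->
  0 <= s <= 1 -> X ((1 - s) *: x + s *: y).
Proof.
move=> cX Xx Xy /andP[s0 s1].
have := cX y x (Itv01 s0 s1) (mem_set Xy) (mem_set Xx).
by rewrite inE addrC.
Qed.

Lemma convex_functionP phi x y (s : R) : convex_function setT phi ->
  0 <= s <= 1 -> phi ((1 - s) *: x + s *: y) <= (1 - s) * phi x + s * phi y.
Proof.
move=> cphi /andP[s0 s1].
have := cphi (Itv01 s0 s1) y x (in_setT _) (in_setT _).
rewrite addrC convRE => h; rewrite [leRHS]addrC; exact: h.
Qed.

Lemma lsc_sublevel_closed phi (c : R) :
  lower_semicontinuous (fun x => (phi x)%:E) -> closed [set x | phi x <= c].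
Proof.
move=> /lower_semicontinuousP/(_ c) op; rewrite -openC.
rewrite (_ : ~` _ = [set x | (c%:E < (phi x)%:E)%E])//.
by apply/seteqP; split => x /=; rewrite lte_fin ltNge => /negP.
Qed.

(** The normalized elements x / |x| with |x| large have a cluster point on the
    unit sphere, and picking ever closer ones gives the required sequences. *)
Lemma unbounded_asymptotic_direction A : ~ bounded_set A ->
  exists2 d, asymptotic_cone A d & d != 0.
Proof.
move=> uA.
have farA (N : nat) : exists2 x, A x & N%:R < `|x|.
  apply: contra_notP uA => nA; apply/bounded_setP; exists N%:R => x Ax.
  by rewrite leNgt; apply/negP => xN; apply: nA; exists x.
pose S : set 'rV[R]_n := [set v | `|v| = 1].
have cS : compact S.
  apply: bounded_closed_compact.
    by apply/bounded_setP; exists 1 => x /= ->.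
  rewrite (_ : S = Num.norm @^-1` [set (1 : R)])//.
  apply: preimage_closed; last exact: closed_eq.
  by move=> x _; exact: norm_continuous.
pose B (N : nat) := [set v | exists x, [/\ A x, N%:R < `|x| & v = `|x|^-1 *: x]].
have BS N : B N `<=` S.
  move=> _ [x [Ax Nx ->]]; rewrite /S/= normrZ normfV normr_id mulVf//.
  by rewrite gt_eqF// (le_lt_trans _ Nx)// ler0n.
have FB : ProperFilter (filter_from setT B).
  apply: filter_from_proper.
    apply: filter_from_filter; first by exists 0%N.
    move=> i j _ _; exists (maxn i j) => // v [x [Ax Nx ->]].
    by split; exists x; split=> //; apply: le_lt_trans Nx;
      rewrite ler_nat ?leq_maxl ?leq_maxr.
  by move=> N _; have [x Ax Nx] := farA N; exists (`|x|^-1 *: x), x.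
have [|d [Sd cld]] := cS _ FB; first by exists 0%N.
exists d; last by rewrite -normr_eq0 Sd oner_eq0.
have appr (k : nat) : exists x, [/\ A x, k%:R < `|x| &
    `|d - `|x|^-1 *: x| < k.+1%:R^-1].
  have [||_ [[x [Ax kx ->]] dx]] := cld (B k) (ball d k.+1%:R^-1).
  - by exists k.
  - by apply: nbhsx_ballx; rewrite invr_gt0.
  - by exists x; split=> //; move: dx; rewrite -ball_normE.
have [x xP] := choice appr.
exists (fun k => `|x k|), x; split.
- apply/cvgryPgt => M; near=> k.
  have [_ kx _] := xP k; apply: lt_trans kx.
  by near: k; exact: nbhs_infty_gtr.
- by move=> k; have [] := xP k.
- apply/cvgrPdist_lt => e e0; near=> k.
  have [_ _ dk] := xP k; apply: lt_trans dk _.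
  by near: k; exact: (near_infty_natSinv_lt (PosNum e0)).
Unshelve. all: by end_near. Qed.

Lemma asymptotic_coneS A X : A `<=` X -> asymptotic_cone A `<=` asymptotic_cone X.
Proof.
by move=> AX d [t [x [ty Ax xd]]]; exists t, x; split=> // k; exact: AX.
Qed.

(** Along the sequences that define d, phi (x k) / t k is at most c / t k, which
    tends to 0. *)
Lemma sublevel_asymptotic_kernel A phi (c : R) :
  (forall x, A x -> phi x <= c) -> asymptotic_cone A `<=` asymptotic_kernel phi.
Proof.
move=> Ac d [t [x [ty Ax xd]]]; rewrite /asymptotic_kernel/=.
pose u k := (phi (t k *: ((t k)^-1 *: x k)) / t k)%:E.
apply: (@le_trans _ _ (limn_einf u)).
  by apply: ereal_inf_lbound; exists t, (fun k => (t k)^-1 *: x k).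
have c0 : (c / t k)%:E @[k --> \oo] --> (0 : R)%:E.
  by apply: cvg_EFin; [exact: nearW|exact: cvgy_div].
rewrite limn_einf_lim -[leRHS](cvg_lim _ c0)//.
apply: lee_lim; [exact: is_cvg_einfs|by apply/cvg_ex; exists 0%:E|].
near=> k.
have tk : 0 < t k by near: k; exact: cvgy_near_gt0.
apply: (@le_trans _ _ (u k)).
  by apply: ereal_inf_lbound; exists k => /=.
rewrite /u lee_fin scalerA mulfV ?gt_eqF// scale1r.
by rewrite ler_pM2r ?invr_gt0// Ac.
Unshelve. all: by end_near. Qed.

(** When v k = y k / t k, the left-hand side is the point of the segment from x
    to y k at parameter s / t k: segments towards points escaping in direction d
    converge to the ray from x in that direction. *)
Lemma cvg_slide (t : nat -> R) (v : nat -> 'rV[R]_n) x d (s : R) :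
  t k @[k --> \oo] --> +oo -> v k @[k --> \oo] --> d ->
  (1 - s / t k) *: x + s *: v k @[k --> \oo] --> x + s *: d.
Proof.
move=> ty vd; rewrite -[in x + _](scale1r x) -[in 1 *: x](subr0 1).
apply: cvgD; last by apply: cvgZ => //; exact: cvg_cst.
apply: cvgZ; last exact: cvg_cst.
by apply: cvgB; [exact: cvg_cst|exact: cvgy_div].
Qed.

Lemma asymptotic_cone_translate X x d (s : R) : closed X -> convex_set X ->
  X x -> asymptotic_cone X d -> 0 <= s -> X (x + s *: d).
Proof.
move=> clX cX Xx [t [y [ty Xy yd]]] s0.
pose z k := (1 - s / t k) *: x + s *: ((t k)^-1 *: y k).
apply: (@closed_cvg _ _ \oo _ z X clX).
  near=> k.
  have tk : 0 < t k by near: k; exact: cvgy_near_gt0.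
  have stk : s <= t k by near: k; move/cvgryPge: ty; exact.
  rewrite /z scalerA; apply: convex_setP => //.
  by rewrite divr_ge0 ?(ltW tk)//= ler_pdivrMr// mul1r.
exact: cvg_slide.
Unshelve. all: by end_near. Qed.

(** If phi (x + s d) exceeded phi x by 4 e, lower semicontinuity would keep phi
    above phi x + 2 e at the points z k of [cvg_slide].  But by convexity
    phi (z k) is at most
    (1 - s / t k) phi x + s (phi (t k d_k) / t k), and the difference quotient
    at infinity is frequently below e / s, so that phi (z k) is frequently at
    most phi x + 2 e. *)
Lemma asymptotic_kernel_descent phi x d (s : R) :
  convex_function setT phi -> lower_semicontinuous (fun x => (phi x)%:E) ->
  asymptotic_kernel phi d -> 0 <= s -> phi (x + s *: d) <= phi x.
Proof.
move=> cphi lphi kd; rewrite le_eqVlt => /predU1P[<-|s0].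
  by rewrite scale0r addr0.
rewrite leNgt; apply/negP => up.
pose e := (phi (x + s *: d) - phi x) / 4.
have e0 : 0 < e by rewrite divr_gt0// subr_gt0.
have : (asymptotic_function phi d < (e / s)%:E)%E.
  by apply: le_lt_trans kd _; rewrite lte_fin divr_gt0.
move=> /ereal_inf_lt[_ [t [dk [ty dkd ->]]] inf_lt].
pose u k := (phi (t k *: dk k) / t k)%:E.
have freq N : exists2 k, (N <= k)%N & phi (t k *: dk k) / t k < e / s.
  have : (einfs u N < (e / s)%:E)%E.
    apply: le_lt_trans inf_lt.
    rewrite limn_einf_lim (cvg_lim _ (@cvg_einfs_sup _ _))//.
    by apply: ereal_sup_ubound; exists N.
  by move=> /ereal_inf_lt[_ [k /= Nk <-]]; rewrite lte_fin; exists k.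
pose z k := (1 - s / t k) *: x + s *: dk k.
have zx : z k @[k --> \oo] --> x + s *: d.
  exact: cvg_slide.
have [|V Vx aV] := lphi (x + s *: d) (phi x + 2 * e).
  by rewrite lte_fin /e; lra.
have zV : \forall k \near \oo, V (z k) by exact: zx.
have small : \forall k \near \oo, `|0 - (s * phi x) / t k| < e.
  by move/cvgrPdist_lt: (cvgy_div t (s * phi x) ty); exact.
have tgt0 := cvgy_near_gt0 _ ty.
have tges : \forall k \near \oo, s <= t k by move/cvgryPge: ty; exact.
have [N _ NP] : \forall k \near \oo, [/\ V (z k), `|0 - (s * phi x) / t k| < e,
    0 < t k & s <= t k].
  by near=> k; split; near: k.
have [k Nk phik] := freq N; have [Vz sm tk stk] := NP _ Nk.
have := aV _ Vz; rewrite lte_fin; apply/negP; rewrite -leNgt.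
have -> : z k = (1 - s / t k) *: x + (s / t k) *: (t k *: dk k).
  by rewrite scalerA mulfVK ?gt_eqF.
apply: le_trans (convex_functionP phi _ _ _ cphi _) _.
  by rewrite divr_ge0 ?(ltW s0) ?(ltW tk)//= ler_pdivrMr// mul1r.
have ph : s / t k * phi (t k *: dk k) <= e.
  by rewrite -mulrA mulrC [_^-1 * _]mulrC -ler_pdivlMr//; exact: ltW.
move: sm; rewrite sub0r normrN => /ltr_normlP[sm _].
rewrite mulrBl mul1r [s / t k * phi x]mulrAC; lra.
Unshelve. all: by end_near. Qed.

(** The nonempty closed sets {x in A : phi x <= phi y}, y in A, form a chain in
    the compact set A; a cluster point of the filter they generate lies in all
    of them. *)
Lemma lsc_minimum A phi : A !=set0 -> closed A -> bounded_set A ->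
  lower_semicontinuous (fun x => (phi x)%:E) ->
  exists2 w, A w & forall y, A y -> phi w <= phi y.
Proof.
move=> [a Aa] clA bA lphi.
pose B y := A `&` [set x | phi x <= phi y].
have FB : ProperFilter (filter_from A B).
  apply: filter_from_proper; last by move=> y Ay; exists y; split=> /=.
  apply: filter_from_filter; first by exists a.
  move=> i j Ai Aj; have [ij|/ltW ji] := leP (phi i) (phi j).
  - by exists i => // x [Ax xi]; split; split=> //; exact: le_trans xi ij.
  - by exists j => // x [Ax xj]; split; split=> //; exact: le_trans xj ji.
have [|w [Aw clw]] := @bounded_closed_compact _ _ _ bA clA _ FB.
  by exists a => // x [].
exists w => // y Ay; apply: (@lsc_sublevel_closed phi (phi y) lphi) => V Vw.
have [|x [[_ xy] Vx]] := clw (B y) V _ Vw; first by exists y.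
by exists x.
Qed.

End Recession.

(** By induction on the number of coordinates allowed to be nonzero, for all
    radii at once: x is the midpoint of a point y with one nonzero coordinate
    less and of a point on the last axis, both of norm at most 2 M.  On the axis
    phi is bounded by its values at the two ends of a segment. *)
Lemma convex_bounded_above (R : realType) (n : nat) (phi : 'rV[R]_n -> R)
    (M : R) : convex_function setT phi ->
  exists C : R, forall x, `|x| <= M -> phi x <= C.
Proof.
move=> cphi.
suff gen (k : nat) : forall M : R, exists C : R, forall x : 'rV[R]_n,
    (forall j : 'I_n, (k <= j)%N -> x ord0 j = 0) -> `|x| <= M -> phi x <= C.
  have [C xC] := gen n M; exists C => x; apply: xC => j.
  by rewrite leqNgt ltn_ord.
elim: k => [|k IH] {}M.
  exists (phi 0) => x x0 _; rewrite (_ : x = 0)//.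
  by apply/rowP => j; rewrite mxE x0.
have [kn|nk] := ltnP k n; last first.
  have [C xC] := IH M; exists C => x _; apply: xC => j kj.
  by have := leq_trans nk kj; rewrite leqNgt ltn_ord.
pose k' := Ordinal kn; pose e : 'rV[R]_n := delta_mx ord0 k'.
have [C xC] := IH (2 * M).
pose D := Num.max (phi (- (2 * M) *: e)) (phi ((2 * M) *: e)).
exists (2^-1 * C + 2^-1 * D) => x x0 xM.
have half : 0 <= (2^-1 : R) <= 1 by lra.
have xkM : `|x ord0 k'| <= M by apply: le_trans (mx_entry_le x ord0 k') xM.
pose y : 'rV[R]_n := \row_j (if j == k' then 0 else 2 * x ord0 j).
have yC : phi y <= C.
  apply: xC => [j kj|].
    rewrite mxE; case: eqP => // /eqP jk; rewrite x0 ?mulr0//.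
    by rewrite ltn_neqAle kj andbT eq_sym.
  rewrite [leLHS]/Num.norm/= mx_normrE; apply/bigmax_leP; split.
    by rewrite mulr_ge0// (le_trans _ xM).
  move=> [i j] _ /=; rewrite mxE; case: eqP => _.
    by rewrite normr0 mulr_ge0// (le_trans _ xM).
  rewrite normrM ger0_norm// ler_pM2l//.
  by rewrite (le_trans _ xM)// mx_entry_le.
have zD : phi ((2 * x ord0 k') *: e) <= D.
  (* For M = 0 the segment is a point, and its parameter s is undefined. *)
  have [M0|M0] := eqVneq M 0.
    move: xkM; rewrite M0 normr_le0 => /eqP ->.
    by rewrite /D M0 mulr0 oppr0 maxxx.
  have Mp : 0 < M by rewrite lt_neqAle eq_sym M0 (le_trans _ xM).
  pose s := (x ord0 k' + M) / (2 * M).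
  have s01 : 0 <= s <= 1.
    have /andP[xl xu] : - M <= x ord0 k' <= M by rewrite -ler_norml.
    rewrite /s ler_pdivrMr ?mulr_gt0// mul1r; apply/andP; split; last by lra.
    by rewrite divr_ge0//; lra.
  have -> : (2 * x ord0 k') *: e = (1 - s) *: (- (2 * M) *: e) + s *: ((2 * M) *: e).
    rewrite !scalerA -scalerDl; congr (_ *: _); rewrite /s; field.
    by [].
  apply: le_trans (convex_functionP phi _ _ _ cphi s01) _.
  have l1 : phi (- (2 * M) *: e) <= D by rewrite le_max lexx.
  have l2 : phi ((2 * M) *: e) <= D by rewrite le_max lexx orbT.
  have /andP[s0 s1] := s01.
  nra.
have -> : x = (1 - 2^-1) *: y + 2^-1 *: ((2 * x ord0 k') *: e).
  apply/rowP => j; rewrite !mxE eqxx/=; case: eqP => [->|_] /=; lra.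
apply: le_trans (convex_functionP phi _ _ _ cphi half) _.
lra.
Qed.

(** * Weak Pareto solutions *)

Section WeakPareto.
Context {R : realType} {m n : nat}.
Variables (X : set 'rV[R]_n) (f : 'I_m -> 'rV[R]_n -> R).

Lemma Solw0 : Solw X f 0 = weak_pareto X f.
Proof.
congr weak_pareto; apply/funext => i; apply/funext => x.
rewrite /perturbed /inner big1 ?subr0// => j _.
by rewrite !mxE mul0r.
Qed.

Lemma weak_pareto_sublevel x0 x : X x0 -> weak_pareto X f x ->
  exists i, f i x <= f i x0.
Proof.
move=> Xx0 [_ nx]; apply: contra_notP nx => nx; exists x0 => // i.
by rewrite ltNge; apply/negP => le; apply: nx; exists i.
Qed.

Lemma weak_pareto_le x y : weak_pareto X f x -> X y ->
  (forall i, f i y <= f i x) -> weak_pareto X f y.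
Proof.
move=> [_ nx] Xy yx; split=> // -[z Xz zy]; apply: nx; exists z => // i.
exact: lt_le_trans (zy i) (yx i).
Qed.

Lemma minimizer_weak_pareto i w : X w -> (forall y, X y -> f i w <= f i y) ->
  weak_pareto X f w.
Proof.
by move=> Xw minw; split=> // -[y /minw wy /(_ i)]; rewrite ltNge wy.
Qed.

(** A point strictly better than w in every component satisfies the same
    constraints. *)
Lemma constrained_minimizer_weak_pareto i (b : 'I_m -> R) w :
  X w -> (forall j, f j w <= b j) ->
  (forall y, X y -> (forall j, f j y <= b j) -> f i w <= f i y) ->
  weak_pareto X f w.
Proof.
move=> Xw wb minw; split=> // -[y Xy yw].
have := yw i; rewrite ltNge minw// => j.
exact: le_trans (ltW (yw j)) (wb j).
Qed.

Hypotheses (clX : closed X) (cX : convex_set X).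
Hypotheses (lf : forall i, lower_semicontinuous (fun x => (f i x)%:E)).
Hypotheses (cf : forall i, convex_function setT (f i)).

(** An asymptotic direction of this set lies in the kernels of all f_j, so that
    no f_j increases along the ray from a weak Pareto point in this direction. *)
Lemma bounded_weak_pareto_sublevels (b : 'I_m -> R) : weak_pareto X f !=set0 ->
  bounded_set (weak_pareto X f) ->
  bounded_set (X `&` [set x | forall j, f j x <= b j]).
Proof.
move=> [x0 Sx0] bS; have [Xx0 _] := Sx0.
apply: contrapT => /unbounded_asymptotic_direction[d cd d0].
have Xd : asymptotic_cone X d.
  by apply: asymptotic_coneS cd => x [].
apply: (ray_unbounded (weak_pareto X f) x0 d d0 _ bS) => s s0.
apply: weak_pareto_le Sx0 _ _ => [|j].
  exact: asymptotic_cone_translate.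
apply: asymptotic_kernel_descent => //.
by apply: (@sublevel_asymptotic_kernel _ _ _ _ (b j) _ _ cd) => x [_].
Qed.

Lemma closed_sublevels (b : 'I_m -> R) :
  closed (X `&` [set x | forall j, f j x <= b j]).
Proof.
apply: closedI => //.
rewrite (_ : [set _ | _] = \bigcap_j [set x | f j x <= b j]).
  by apply: closed_bigI => j _; exact: lsc_sublevel_closed.
by apply/seteqP; split => x /= xb j; [move=> _|]; exact: xb.
Qed.

(** The minimizer of f_i under upper bounds on all components is weakly Pareto,
    so it lies in a ball known in advance.  The bounds on the components other
    than i are chosen slack on that ball, which makes the constrained minimum a
    local, hence a global one. *)
Lemma bounded_weak_pareto_minimizer i : weak_pareto X f !=set0 ->
  bounded_set (weak_pareto X f) ->
  exists2 w, X w & forall y, X y -> f i w <= f i y.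
Proof.
move=> S0 bS; have [x0 Sx0] := S0; have [Xx0 _] := Sx0.
have [M SM] := (bounded_setP _).1 bS.
have [C CP] := choice (fun j => convex_bounded_above R n (f j) M (cf j)).
pose b j := if j == i then f i x0 else C j + 1.
have b0 j : f j x0 <= b j.
  rewrite /b; case: eqP => [->//|_].
  by rewrite (le_trans (CP j _ (SM _ Sx0)))// lerDl.
pose A := X `&` [set x | forall j, f j x <= b j].
have [w [Xw wb] minw] : exists2 w, A w & forall y, A y -> f i w <= f i y.
  apply: lsc_minimum => //; [by exists x0|exact: closed_sublevels|].
  exact: bounded_weak_pareto_sublevels.
have Sw : weak_pareto X f w.
  apply: (constrained_minimizer_weak_pareto i b) => // y Xy yb.
  exact: minw.
exists w => // y Xy; rewrite leNgt; apply/negP => yw.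
(* A step s from w towards y keeps f j at or below C j + 1, since f j w <= C j,
   f j y <= C j + K and s K <= 1. *)
pose K := \sum_j (`|f j y - C j|).
have K0 : 0 <= K by apply: sumr_ge0.
pose s := (K + 1)^-1.
have s0 : 0 < s by rewrite invr_gt0 ltr_wpDl.
have s01 : 0 <= s <= 1.
  by rewrite (ltW s0)/= invf_le1 ?ltr_wpDl// lerDr.
have /andP[_ s1] := s01.
have sK : s * K <= 1.
  by rewrite mulrC ler_pdivrMr ?ltr_wpDl// mul1r lerDl.
have lt : f i ((1 - s) *: w + s *: y) < f i w.
  apply: le_lt_trans (convex_functionP _ _ _ _ (cf i) s01) _; nra.
have := lt; rewrite ltNge minw//; split; first exact: convex_setP.
move=> j; rewrite /b; case: eqP => [->|_].
  by apply: le_trans (ltW lt) _; have := wb i; rewrite /b eqxx.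
apply: le_trans (convex_functionP _ _ _ _ (cf j) s01) _.
have wC : f j w <= C j by apply: CP; exact: SM.
have yK : f j y - C j <= K.
  rewrite (le_trans (ler_norm _))// /K (bigD1 j)//= lerDl.
  exact: sumr_ge0.
nra.
Qed.

End WeakPareto.

Theorem theorem4p3 (R : realType) (m n : nat)
    (X : set 'rV[R]_n) (f : 'I_m -> 'rV[R]_n -> R)
    (X_closed : closed X)
    (X_unbounded : ~ bounded_set X)
    (f_lsc : forall i, lower_semicontinuous (fun x => (f i x)%:E))
    (X_convex : convex_set X)
    (f_convex : forall i, convex_function setT (f i))
    (Sol_lsc : set_valued_lsc_at (Solw X f) 0) :
  bounded_set (Solw X f 0) <->
  asymptotic_cone X `&` (\bigcup_i asymptotic_kernel (f i)) = [set 0].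
Proof.
have [S0 _] := Sol_lsc; move: S0; rewrite Solw0 => S0.
have [x0 [Xx0 nx0]] := S0.
split=> [bS|rec0].
- apply/seteqP; split=> [d [Xd [i _ kd]]|_ ->].
    apply/eqP; apply: contraPT bS => d0 bS.
    have [w Xw minw] :=
      bounded_weak_pareto_minimizer X f X_closed X_convex f_lsc f_convex i S0 bS.
    apply: (ray_unbounded _ w d d0 _ bS) => s s0.
    apply: (minimizer_weak_pareto X f i) => [|y Xy].
      exact: asymptotic_cone_translate.
    by apply: le_trans (minw _ Xy); exact: asymptotic_kernel_descent.
  (* The direction 0 is asymptotic to {x0} because x0 / k tends to 0; there is
     a component i because with none no point is weakly Pareto. *)
  have cone0 : asymptotic_cone [set x0] 0.
    exists (fun k => k%:R), (fun=> x0); split=> //; first exact: cvgr_idn.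
    rewrite -(scale0r x0); apply: cvgZ; last exact: cvg_cst.
    by apply: cvgy_inv0; exact: cvgr_idn.
  split.
    by apply: asymptotic_coneS cone0 => x ->.
  have [i _] : exists i, f i x0 <= f i x0.
    exact: (weak_pareto_sublevel X f).
  exists i => //; apply: (sublevel_asymptotic_kernel [set x0]) cone0 => x ->.
  exact: lexx.
- apply: contrapT => uS.
  have [i uSi] : exists i, ~ bounded_set (X `&` [set x | f i x <= f i x0]).
    apply: contra_notP uS => bSi.
    have bP i : exists M : R, forall x,
        (X `&` [set x | f i x <= f i x0]) x -> `|x| <= M.
      apply/bounded_setP; apply: contrapT => ui; apply: bSi.
      by exists i.
    have [M MP] := choice bP; apply/bounded_setP.
    exists (\sum_i `|M i|) => x Sx; have [Xx _] := Sx.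
    have [i xi] := weak_pareto_sublevel X f x0 x Xx0 Sx.
    have xM : `|x| <= M i by apply: MP.
    rewrite (le_trans xM)// (le_trans (ler_norm _))// (bigD1 i)//= lerDl.
    exact: sumr_ge0.
  have [d cd d0] := unbounded_asymptotic_direction _ uSi.
  suff: d = 0 by apply/eqP.
  have : (asymptotic_cone X `&` \bigcup_i asymptotic_kernel (f i)) d.
    split.
      by apply: asymptotic_coneS cd => x [].
    exists i => //; apply: sublevel_asymptotic_kernel cd => x [_].
    exact.
  by rewrite rec0.
Qed.
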